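(* Let $b_1,b_2\in\mathbb C$ and let $z,w$ be the functions $z=\frac12\left(e^x+e^{-x}-2\right)^{1/2}$, $w=\frac12\left(e^x+e^{-x}+2\right)^{1/2}$ of the variable $x$. For nonnegative integers $k,l,m$ put $$T_{(k,l,m)}=U_m(b_1+k,b_2+l)\,X(k,l,m),$$ with $U_m$ and $X$ as defined in the context. Then the functions $T_{(k,l,m)}$ satisfy the Hirota–Miwa equation: for all integers $k,l,m\ge 1$, $$T_{(k-1,l,m)}T_{(k+1,l,m)}+T_{(k,l-1,m)}T_{(k,l+1,m)}+T_{(k,l,m-1)}T_{(k,l,m+1)}=0 .$$
   Context: Let $[0;m]=\{2,4,\ldots,2m\}$. For a finite set $I$ of positive integers, $|I|$ denotes the SUM of its elements. For parameters $a,b$ put $\bar a_k=a+(k-1)^2$, $\bar b_k=b+(k-1)^2$, $a_{2k}=\bar a_2\bar a_4\cdots\bar a_{2k}$, $b_{2k}=\bar b_2\bar b_4\cdots\bar b_{2k}$, $a_I=\prod_{i\in I}a_i$, $b_I=\prod_{i\in I}b_i$. Define $$U_{0,m}(z,w;a,b)=\sum_{I\subset[0;m]}\ \prod_{i\in I,\ j\in[0;m]\setminus I}\left|\frac{i+j}{i-j}\right|\,(-1)^{|I|/2}\,a_I\,b_{[0;m]\setminus I}\,z^{|I|}\,w^{|[0;m]\setminus I|},$$ and let $U_m(\beta_1,\beta_2)$ denote $U_{0,m}(z,w;-4\beta_1^2,-4\beta_2^2)$ (an Umemura polynomial). The variable $x$ may be taken real positive, with positive square roots; then $w^2-z^2=1$.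 Rescaling factors: for integers $k,l,m$ put $$\bar Y_{(l,m)}=\left(4(b_2+l)^2-(2m+1)^2\right)w^2,\qquad \bar Z_{(k,m)}=\left(-4(b_1+k)^2+(2m+1)^2\right)z^2,$$ $$Y_{(l,m)}(n)=\prod_{j=1}^{n}\bar Y_{(l,m-n-1+2j)},\qquad Z_{(k,m)}(n)=\prod_{j=1}^{n}\bar Z_{(k,m-n-1+2j)},$$ $$X(k,l,m)=\prod_{j=1}^{k-1}Y_{(l,m)}(j)\ \prod_{j=1}^{l-1}Z_{(k,m)}(j),$$ where empty products equal $1$ (in particular $X(0,0,m)=X(0,1,m)=X(1,0,m)=X(1,1,m)=1$). These satisfy $X(k-1,l,m)X(k+1,l,m)=\bar Y_{(l,m)}X(k,l,m-1)X(k,l,m+1)$ and $X(k,l-1,m)X(k,l+1,m)=\bar Z_{(k,m)}X(k,l,m-1)X(k,l,m+1)$. *)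

(* Defs.v *)
From HB Require Import structures.
From mathcomp Require Import all_boot all_order all_algebra.
From mathcomp Require Import complex.
From mathcomp Require Import reals sequences exp.

Set Implicit Arguments.
Unset Strict Implicit.
Unset Printing Implicit Defensive.

Import Order.TTheory GRing.Theory Num.Theory.
Local Open Scope ring_scope.

(* A subset I of [0;m] = {2, 4, ..., 2m} is encoded as a set I : {set 'I_m}:
   the ordinal i stands for the element 2(i+1), and the complement ~: I
   for [0;m] \ I. *)
Definition elt (m : nat) (i : 'I_m) : nat := (2 * i.+1)%N.

(* This is the quantity written |I| on paper: the sum of the elements of I,
   not its cardinal. *)
Definition wt (m : nat) (I : {set 'I_m}) : nat := (\sum_(i in I) elt i)%N.

Definition bar (F : numFieldType) (a : F) (k : nat) : F :=
  a + (k%:R - 1) ^+ 2.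

(* The number a_n, for even n = 2k only: a_(2k) is the product of
   bar a 2, bar a 4, ..., bar a (2k). *)
Definition coef (F : numFieldType) (a : F) (n : nat) : F :=
  \prod_(1 <= j < (n./2).+1) bar a (2 * j)%N.

Definition coef_set (F : numFieldType) (a : F) (m : nat) (I : {set 'I_m}) : F :=
  \prod_(i in I) coef a (elt i).

Definition U0 (F : numFieldType) (m : nat) (z w a b : F) : F :=
  \sum_(I : {set 'I_m})
    (\prod_(i in I) \prod_(j in ~: I)
       `| ((elt i)%:R + (elt j)%:R) / ((elt i)%:R - (elt j)%:R) |)
    * (-1) ^+ (wt I)./2 * coef_set a I * coef_set b (~: I)
    * z ^+ wt I * w ^+ wt (~: I).

Definition Umemura (F : numFieldType) (m : nat) (z w beta1 beta2 : F) : F :=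
  U0 m z w (- 4 * beta1 ^+ 2) (- 4 * beta2 ^+ 2).

(* The index m is an integer, because m - n - 1 + 2j in Y_ and Z_
   below may be negative. *)
Definition Ybar (F : numFieldType) (b2 w : F) (l m : int) : F :=
  (4 * (b2 + l%:~R) ^+ 2 - (2 * m%:~R + 1) ^+ 2) * w ^+ 2.

Definition Zbar (F : numFieldType) (b1 z : F) (k m : int) : F :=
  (- 4 * (b1 + k%:~R) ^+ 2 + (2 * m%:~R + 1) ^+ 2) * z ^+ 2.

Definition Y_ (F : numFieldType) (b2 w : F) (l m : int) (n : nat) : F :=
  \prod_(1 <= j < n.+1) Ybar b2 w l (m - n%:Z - 1 + 2 * j%:Z).

Definition Z_ (F : numFieldType) (b1 z : F) (k m : int) (n : nat) : F :=
  \prod_(1 <= j < n.+1) Zbar b1 z k (m - n%:Z - 1 + 2 * j%:Z).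

Definition Xfac (F : numFieldType) (b1 b2 z w : F) (k l m : nat) : F :=
  (\prod_(1 <= j < k) Y_ b2 w l%:Z m%:Z j)
  * (\prod_(1 <= j < l) Z_ b1 z k%:Z m%:Z j).

Definition zfun (R : realType) (x : R) : R[i] :=
  (2^-1 * Num.sqrt (expR x + expR (- x) - 2))%:C%C.

Definition wfun (R : realType) (x : R) : R[i] :=
  (2^-1 * Num.sqrt (expR x + expR (- x) + 2))%:C%C.

Definition T_ (R : realType) (b1 b2 : R[i]) (k l m : nat) (x : R) : R[i] :=
  Umemura m (zfun x) (wfun x) (b1 + k%:R) (b2 + l%:R)
  * Xfac b1 b2 (zfun x) (wfun x) k l m.

(* Main.v *)
Require Import Defs.
From HB Require Import structures.
From mathcomp Require Import all_boot all_order all_algebra.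
From mathcomp Require Import complex.
From mathcomp Require Import reals sequences exp.
From mathcomp Require Import perm ring zify.

Import Order.TTheory GRing.Theory Num.Theory.
Local Open Scope ring_scope.

Set Implicit Arguments.
Unset Strict Implicit.
Unset Printing Implicit Defensive.

(** The rescaling factors X only serve to absorb the coefficients Ybar and Zbar:
    by [Xfac_k] and [Xfac_l] the claim is a multiple of the bilinear relation
    [Umemura_bilinear] between the polynomials U alone.

    For that relation put b = 2 beta1, c = 2 beta2, Z = z^2, W = w^2. The
    products a_(2n) and b_(2n) are A_n = prod_(j < n) ((2j+1)^2 - b^2) and its
    analogue B_n in c. Let L_n be the linear form on polynomials

      L_n(q) = B_n W^n q(2n) - A_n Z^n q(-2n).

    Expanding each row of tau_m = det (L_i(X^j)) (1 <= i <= m, 0 <= j < m) into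
    its two terms gives a sum over subsets of Vandermonde determinants with
    nodes 2i and -2i, and the factors |(i+j)/(i-j)| are the quotients of their
    values by the Vandermonde determinant with positive nodes. So U_m is tau_m
    up to a constant ([tau_Umemura]).

    Bordering this matrix by the row 1, X, ..., X^m gives a polynomial G of
    degree at most m that is killed by L_1, ..., L_m ([baker]). Its value at
    alpha is, up to sign, the determinant of the forms q -> L_i((X - alpha) q).
    Since (2n - 1 - b) A_n(b + 2) = - (2n + 1 + b) A_n(b), replacing b by b + 2
    turns L_n(q) into L_n((X - 1 - b) q) up to a scalar. Shifts of c act in the
    same way, with X + 1 + c. Hence the shifted tau functions are values of G
    ([tau_shift1], [tau_shift2]):

      A_m tau_m(b-2) tau_m(b+2) = G(1+b) G(1-b),
      B_m tau_m(c-2) tau_m(c+2) = G(c-1) G(-c-1).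

    Both products occur in the values of one even polynomial of degree at most 2m + 2,

      P(v) = Z (v^2 - b^2) G(v-1) G(-v-1) - W (v^2 - c^2) G(v+1) G(1-v),

    at v = b, where the first term drops out, and at v = c, where the second
    does. The equations L_n(G) = 0 make P vanish at v = 1, 3, ..., 2m - 1
    ([master_poly_root]), so P(v) is the product of the v^2 - (2n-1)^2 for
    n <= m with a polynomial s2 v^2 + s0 ([even_poly_factor]). Two scalars
    remain, and therefore P(b), P(c) and P(2m+1) satisfy a linear relation. The
    third value is a multiple of tau_(m-1) tau_(m+1), because L_(m+1)(G) =
    tau_(m+1) and G(-2m) is a multiple of tau_(m-1) ([master_poly_next],
    [baker_edge]); the linear relation is the bilinear relation.

    This argument divides by W, which is positive, and by A_m, B_m and
    c^2 - b^2, which may vanish. The general case follows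
    by moving (b, c) along the line (b + t, c + 2t), where the relation is
    polynomial in t and holds outside finitely many t ([hirota_form0]). *)

(** * Determinants of linear forms on polynomials *)

Section Moments.
Variable R : comNzRingType.
Implicit Types (f : {poly R} -> R) (Phi : nat -> {poly R} -> R) (p : {poly R}).

Definition moment Phi n : R := \det (\matrix_(i < n, j < n) Phi i 'X^j).

Lemma scalar_expand f n p : scalar f -> (size p <= n)%N ->
  f p = \sum_(k < n) p`_k * f 'X^k.
Proof.
move=> lf sp.
pose F : {scalar {poly R}} := HB.pack f (GRing.isLinear.Build _ _ _ _ f lf).
rewrite -[f]/(F : _ -> _) -[p in LHS]coefK poly_def linear_sum /=.
rewrite (big_ord_widen _ (fun k => f (p`_k *: 'X^k)) sp) big_mkcond /=.
apply: eq_bigr => k _; case: ifP => [_|/negbT]; first exact: (linearZ_LR F).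
by rewrite -leqNgt => /(nth_default 0) ->; rewrite mul0r.
Qed.

(** The change of basis from the powers of X to a graded monic family is
    unitriangular. *)
Lemma moment_basis Phi n (q : nat -> {poly R}) :
  (forall i, scalar (Phi i)) ->
  (forall j, q j \is monic) -> (forall j, size (q j) = j.+1) ->
  \det (\matrix_(i < n, j < n) Phi i (q j)) = moment Phi n.
Proof.
move=> lin mon sz.
pose N : 'M[R]_n := \matrix_(k, j) (q j)`_k.
have -> : \matrix_(i < n, j < n) Phi i (q j)
    = (\matrix_(i < n, j < n) Phi i 'X^j) *m N.
  apply/matrixP => i j; rewrite !mxE (@scalar_expand _ n) ?sz //.
  by apply: eq_bigr => k _; rewrite !mxE mulrC.
rewrite det_mulmx -(det_tr N) [\det N^T]det_trig; last first.
  by apply/is_trig_mxP => i j ij; rewrite !mxE nth_default // sz.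
rewrite big1 ?mulr1 // => i _; rewrite !mxE.
by have /monicP := mon i; rewrite lead_coefE sz.
Qed.

(** In the basis 1, (X - al), (X - al) X, (X - al) X^2, ... a last row that is
    evaluation at al has a single nonzero entry. *)
Lemma moment_eval Phi m r al :
  (forall i, scalar (Phi i)) -> (forall q, Phi m q = r * q.[al]) ->
  moment Phi m.+1
  = (-1) ^+ m * r * moment (fun i p => Phi i (('X - al%:P) * p)) m.
Proof.
move=> lin last.
pose q j : {poly R} := if j is j'.+1 then ('X - al%:P) * 'X^j' else 1.
rewrite -(@moment_basis Phi m.+1 q) //; last 2 first.
- by case=> [|j]; rewrite /q ?monic1 // monicMr ?monicXsubC ?monicXn.
- case=> [|j]; rewrite /q ?size_poly1 //.
  by rewrite size_monicM ?monicXsubC ?monic_neq0 ?monicXn // size_XsubC size_polyXn.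
rewrite (expand_det_row _ ord_max) big_ord_recl big1 => [|j _]; last first.
  have e : Phi m (q j.+1) = 0 by rewrite last hornerM hornerXsubC subrr mul0r mulr0.
  by rewrite mxE lift0 e; apply: mul0r.
rewrite mxE last /= hornerC mulr1 addr0 /cofactor addn0 mulrCA mulrA.
congr (_ * \det _); apply/matrixP => i j; rewrite !mxE /q lift0 /=.
by rewrite /bump leqNgt ltn_ord.
Qed.

Definition replace_form Phi m f i := if i == m then f else Phi i.

Lemma replace_form_scalar Phi m f : (forall i, scalar (Phi i)) -> scalar f ->
  forall i, scalar (replace_form Phi m f i).
Proof. by move=> lP lf i; rewrite /replace_form; case: eqP. Qed.

(** The vector of cofactors of the last row: it pairs with any other last row f
    to the determinant of the system in which f replaces that row, so the form
    of index m does not influence it. *)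
Definition annihilator Phi m : {poly R} :=
  \poly_(j < m.+1)
     cofactor (\matrix_(i < m.+1, j < m.+1) Phi i 'X^j) ord_max (inord j).

Lemma annihilatorE Phi m f : scalar f ->
  f (annihilator Phi m) = moment (replace_form Phi m f) m.+1.
Proof.
move=> lf; rewrite (scalar_expand lf (size_poly _ _)).
rewrite /moment (expand_det_row _ ord_max); apply: eq_bigr => j _.
rewrite coef_poly ltn_ord inord_val mulrC; congr (_ * _).
  by rewrite mxE /replace_form /= eqxx.
congr (_ * \det _); apply/matrixP => i k; rewrite !mxE /replace_form /=.
by rewrite /bump leqNgt ltn_ord /= add0n ltn_eqF.
Qed.

Lemma annihilator0 Phi m i : (forall i, scalar (Phi i)) -> (i < m)%N ->
  Phi i (annihilator Phi m) = 0.
Proof.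
move=> lin im; rewrite annihilatorE // /moment.
have imS : (i < m.+1)%N by apply: leqW.
apply: (determinant_alternate (i1 := Ordinal imS) (i2 := ord_max)).
  by rewrite -val_eqE /= ltn_eqF.
by move=> j; rewrite !mxE /replace_form /= eqxx ltn_eqF.
Qed.

Lemma horner_scalar al : scalar (fun p => p.[al]).
Proof. by move=> a u v; rewrite !hornerE. Qed.

Lemma eq_moment Phi Psi n : (forall i j, (i < n)%N -> Phi i 'X^j = Psi i 'X^j) ->
  moment Phi n = moment Psi n.
Proof.
move=> eqf; congr (\det _); apply/matrixP => i j; rewrite !mxE.
exact/eqf/ltn_ord.
Qed.

(** A Christoffel formula: evaluating the annihilator at al multiplies the
    argument of every form by X - al. *)
Lemma annihilator_horner Phi m al : (forall i, scalar (Phi i)) ->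
  (annihilator Phi m).[al]
  = (-1) ^+ m * moment (fun i p => Phi i (('X - al%:P) * p)) m.
Proof.
move=> lin; rewrite (annihilatorE _ _ (horner_scalar al)).
rewrite (@moment_eval _ _ 1 al); last 2 first.
- exact: replace_form_scalar (horner_scalar al).
- by move=> q; rewrite /replace_form eqxx mul1r.
rewrite mulr1; congr (_ * _); apply: eq_moment => i j im.
by rewrite /replace_form ltn_eqF.
Qed.

Lemma moment_scale Phi (d : nat -> R) n :
  moment (fun i p => d i * Phi i p) n = (\prod_(i < n) d i) * moment Phi n.
Proof.
rewrite /moment.
have -> : \matrix_(i < n, j < n) (d i * Phi i 'X^j)
   = diag_mx (\row_i d i) *m \matrix_(i < n, j < n) Phi i 'X^j.
  by apply/matrixP => i j; rewrite mul_diag_mx !mxE.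
rewrite det_mulmx det_diag; congr (_ * _).
by apply: eq_bigr => i _; rewrite mxE.
Qed.

End Moments.

(** * The tau function and its shifts in the parameters *)

Section Tau.
Variable R : comNzRingType.
Implicit Types (b c Z W : R) (q : {poly R}).

Definition odd_prod b n : R := \prod_(j < n) (((2 * j).+1)%:R ^+ 2 - b ^+ 2).

Definition node_form b c Z W n q : R :=
  odd_prod c n * W ^+ n * q.[(2 * n)%:R] - odd_prod b n * Z ^+ n * q.[- (2 * n)%:R].

Definition tau b c Z W m : R := moment (fun i => node_form b c Z W i.+1) m.

Lemma node_form_scalar b c Z W n : scalar (node_form b c Z W n).
Proof. by move=> a u v; rewrite /node_form !(hornerD, hornerZ) /=; ring. Qed.

Lemma odd_prodS b n :
  odd_prod b n.+1 = odd_prod b n * ((2 * n).+1%:R ^+ 2 - b ^+ 2).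
Proof. by rewrite /odd_prod big_ord_recr. Qed.

Lemma odd_prodN b n : odd_prod (- b) n = odd_prod b n.
Proof. by apply: eq_bigr => j _; rewrite sqrrN. Qed.

(** In (2j+1 - b)(2j+1 + b) the shift of b by 2 moves the two families of linear
    factors by one place in opposite directions, so that only the extreme factors
    change. *)
Lemma odd_prod_shift b n :
  ((2 * n)%:R - (1 + b)) * odd_prod (b + 2) n
  = - (((2 * n)%:R + (1 + b)) * odd_prod b n).
Proof.
elim: n => [|n IH]; first by rewrite /odd_prod !big_ord0 muln0; ring.
have e1 : (2 * n.+1)%:R = (2 * n)%:R + 2 :> R by rewrite mulnS addnC natrD.
rewrite !odd_prodS e1 -natr1; move: IH; set u := (2 * n)%:R => IH.
transitivity ((u - (1 + b)) * odd_prod (b + 2) n * ((u + 1 - b) * (u + 3 + b))).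
  by ring.
by rewrite IH; ring.
Qed.

Lemma tauN1 b c Z W m : tau (- b) c Z W m = tau b c Z W m.
Proof. by apply: eq_moment => i j _; rewrite /node_form odd_prodN. Qed.

Lemma tauN2 b c Z W m : tau b (- c) Z W m = tau b c Z W m.
Proof. by apply: eq_moment => i j _; rewrite /node_form odd_prodN. Qed.

(** Up to normalization, the polynomial part of a Baker-Akhiezer function: the
    forms [node_form] are its gluing conditions between the nodes 2n and -2n. *)
Definition baker b c Z W m : {poly R} :=
  annihilator (fun i => node_form b c Z W i.+1) m.

Lemma bakerN1 b c Z W m : baker (- b) c Z W m = baker b c Z W m.
Proof.
apply/polyP => j; rewrite !coef_poly; case: ifP => // _.
congr (_ * \det _); apply/matrixP => i k; rewrite !mxE /=.
by rewrite /node_form odd_prodN.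
Qed.

Lemma bakerN2 b c Z W m : baker b (- c) Z W m = baker b c Z W m.
Proof.
apply/polyP => j; rewrite !coef_poly; case: ifP => // _.
congr (_ * \det _); apply/matrixP => i k; rewrite !mxE /=.
by rewrite /node_form odd_prodN.
Qed.


(** Only the term of the form at the node -2n depends on b; there 1 + b + 2n and
    2n - (1 + b) are, up to sign, the values of X - (1 + b) at -2n and 2n. *)
Lemma baker_shift1 b c Z W m :
  (\prod_(i < m) ((2 * i.+1)%:R - (1 + b))) * tau (b + 2) c Z W m
  = (-1) ^+ m * (baker b c Z W m).[1 + b].
Proof.
rewrite annihilator_horner; last by move=> i; apply: node_form_scalar.
rewrite mulrA -exprD addnn -mul2n exprM sqrrN expr1n expr1n mul1r.
rewrite /tau -(moment_scale _ (fun i => (2 * i.+1)%:R - (1 + b))).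
apply: eq_moment => i j _; rewrite /node_form !(hornerM, hornerXsubC, hornerXn).
have := odd_prod_shift b i.+1; move: i.+1 => n.
move: (odd_prod (b + 2) n) => u e.
rewrite mulrBr !mulrA [X in _ - X * _ * _]e; ring.
Qed.

Lemma baker_shift2 b c Z W m :
  (\prod_(i < m) ((2 * i.+1)%:R - (1 + c))) * tau b (c + 2) Z W m
  = (baker b c Z W m).[- (1 + c)].
Proof.
rewrite annihilator_horner; last by move=> i; apply: node_form_scalar.
rewrite -[(-1) ^+ m](_ : \prod_(i < m) -1 = _); last first.
  by rewrite prodr_const card_ord.
rewrite /tau -(moment_scale _ (fun i => (2 * i.+1)%:R - (1 + c))).
rewrite -(moment_scale _ (fun=> -1)).
apply: eq_moment => i j _; rewrite /node_form !(hornerM, hornerXsubC, hornerXn).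
have := odd_prod_shift c i.+1; move: i.+1 => n.
move: (odd_prod (c + 2) n) => u e.
rewrite mulrBr !mulrA [X in X * _ * _ - _]e; ring.
Qed.

(** The left side collects the normalizing factors of [baker_shift1] for the
    shifts of b by 2 and by -2. *)
Lemma odd_prod_split b m :
  (\prod_(i < m) ((2 * i.+1)%:R - (1 + b)))
  * (\prod_(i < m) ((2 * i.+1)%:R - (1 - b))) = odd_prod b m.
Proof.
rewrite -big_split; apply: eq_bigr => i _ /=.
by rewrite mulnS addnC natrD -natr1; ring.
Qed.

Lemma tau_shift1 b c Z W m :
  odd_prod b m * (tau (b - 2) c Z W m * tau (b + 2) c Z W m)
  = (baker b c Z W m).[1 + b] * (baker b c Z W m).[1 - b].
Proof.
have e1 := baker_shift1 b c Z W m; have e2 := baker_shift1 (- b) c Z W m.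
rewrite bakerN1 in e2.
rewrite -(tauN1 (b - 2)) opprB [2 - b]addrC -odd_prod_split.
transitivity ((-1) ^+ m * (-1) ^+ m
  * ((baker b c Z W m).[1 + b] * (baker b c Z W m).[1 - b])).
  by rewrite mulrACA -[RHS]mulrACA -e1 -e2; ring.
by rewrite -exprD addnn -mul2n exprM sqrrN !expr1n mul1r.
Qed.

Lemma tau_shift2 b c Z W m :
  odd_prod c m * (tau b (c - 2) Z W m * tau b (c + 2) Z W m)
  = (baker b c Z W m).[c - 1] * (baker b c Z W m).[- c - 1].
Proof.
have e1 := baker_shift2 b c Z W m; have e2 := baker_shift2 b (- c) Z W m.
rewrite bakerN2 in e2.
rewrite -(tauN2 b (c - 2)) opprB [2 - c]addrC -odd_prod_split.
have -> : c - 1 = - (1 - c) by ring.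
have -> : - c - 1 = - (1 + c) by ring.
by rewrite -e1 -e2; ring.
Qed.

Lemma baker_annihilated b c Z W m n : (0 < n <= m)%N ->
  node_form b c Z W n (baker b c Z W m) = 0.
Proof.
case: n => // n /= nm; rewrite /baker.
apply: (annihilator0 (Phi := fun i => node_form b c Z W i.+1)) => // i.
exact: node_form_scalar.
Qed.

Lemma baker_next b c Z W m :
  node_form b c Z W m.+1 (baker b c Z W m) = tau b c Z W m.+1.
Proof.
rewrite /baker (annihilatorE _ _ (@node_form_scalar b c Z W m.+1)) /tau.
by apply: eq_moment => i j _; rewrite /replace_form; case: eqP => [->|].
Qed.

(** Let u = 2(m + 1). After multiplication by X + u the form at the last node
    only evaluates at u, so that [moment_eval] removes it. In the other forms the
    argument gets the factor X^2 - u^2, which takes the same value at 2i and -2i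
    and so comes out as a scalar. *)
Lemma baker_edge b c Z W m :
  (baker b c Z W m.+1).[- (2 * m.+1)%:R]
  = - ((4 * m.+1)%:R * odd_prod c m.+1 * W ^+ m.+1
       * (\prod_(i < m) ((2 * i.+1)%:R ^+ 2 - (2 * m.+1)%:R ^+ 2))
       * tau b c Z W m).
Proof.
rewrite annihilator_horner; last by move=> i; apply: node_form_scalar.
set al := (2 * m.+1)%:R.
rewrite (@moment_eval _ _ _ ((4 * m.+1)%:R * odd_prod c m.+1 * W ^+ m.+1) al);
  last 2 first.
- by move=> i a u v; rewrite mulrDr -scalerAr node_form_scalar.
- move=> q; rewrite /node_form !(hornerM, hornerXsubC, hornerXn) -/al.
  rewrite subrr !mul0r mulr0 subr0.
  have -> : (4 * m.+1)%:R = al + al by rewrite -natrD; congr (_%:R); lia.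
  by ring.
set M := moment _ _.
have -> : M = (\prod_(i < m) ((2 * i.+1)%:R ^+ 2 - al ^+ 2)) * tau b c Z W m.
  rewrite /tau -(moment_scale _ (fun i => (2 * i.+1)%:R ^+ 2 - al ^+ 2)).
  apply: eq_moment => i j _.
  by rewrite /node_form !(hornerM, hornerXsubC, hornerXn); ring.
rewrite !mulrA -exprD addSn addnn exprS -mul2n exprM sqrrN !expr1n.
by ring.
Qed.

End Tau.

(** * The interpolating even polynomial *)

Section Interpolation.
Variable F : numFieldType.
Implicit Types (b c Z W v : F).

Definition odd_root_prod (n : nat) v : F :=
  \prod_(j < n) (v ^+ 2 - (2 * j).+1%:R ^+ 2).

Lemma odd_root_prodE n v : odd_root_prod n v = (-1) ^+ n * odd_prod v n.
Proof.
rewrite /odd_root_prod -[n in (-1) ^+ n]card_ord -prodr_const -big_split.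
by apply: eq_bigr => i _ /=; ring.
Qed.

Lemma odd_root_prod_neq0 m : odd_root_prod m ((2 * m).+1%:R : F) != 0.
Proof.
apply/prodf_neq0 => i _; rewrite subr_eq0 -!natrX eqr_nat eqn_sqr.
by have := ltn_ord i; lia.
Qed.


(** An even polynomial that vanishes at 1, 3, ..., 2n - 1 also vanishes at their
    opposites. This leaves a quadratic cofactor, again even. *)
Lemma even_poly_factor (p : {poly F}) n :
  (forall v, p.[- v] = p.[v]) -> (size p <= (2 * n).+3)%N ->
  (forall j, (j < n)%N -> p.[(2 * j).+1%:R] = 0) ->
  exists s2 s0, forall v, p.[v] = odd_root_prod n v * (s2 * v ^+ 2 + s0).
Proof.
move=> pev sp p0.
pose rs := [seq (2 * j).+1%:R | j <- iota 0 n] ++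
           [seq - (2 * j).+1%:R | j <- iota 0 n] : seq F.
have [q pq] : exists q : {poly F}, p = q * \prod_(z <- rs) ('X - z%:P).
  apply: uniq_roots_prod_XsubC.
    rewrite all_cat !all_map; apply/andP; split; apply/allP => j;
    rewrite mem_iota /= => jn; rewrite /root ?pev; apply/eqP; exact: p0.
  have inj : injective (fun j => (2 * j).+1%:R : F).
    by move=> i j /eqP; rewrite eqr_nat => /eqP; lia.
  rewrite uniq_rootsE cat_uniq (map_inj_uniq inj) iota_uniq /=.
  rewrite map_inj_uniq ?iota_uniq ?andbT; last by move=> i j /oppr_inj /inj.
  apply/hasPn => _ /mapP[j _ ->]; apply/mapP => -[i _ /eqP].
  by rewrite eq_sym -addr_eq0 -natrD pnatr_eq0.
have evrs v : (\prod_(z <- rs) ('X - z%:P)).[v] = odd_root_prod n v.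
  rewrite big_cat !big_map hornerM !horner_prod -big_split /odd_root_prod.
  rewrite -[n in RHS]subn0.
  rewrite -(big_mkord xpredT (fun j => v ^+ 2 - (2 * j).+1%:R ^+ 2)).
  rewrite /index_iota !subn0; apply: eq_bigr => j _ /=.
  by rewrite !hornerXsubC; ring.
have sq : (size q <= 3)%N.
  have [->|q0] := eqVneq q 0; first by rewrite size_poly0.
  move: sp; rewrite pq size_Mmonic ?monic_prod_XsubC // size_prod_XsubC.
  by rewrite size_cat !size_map size_iota; lia.
have eq v : q.[v] = q`_0 + q`_1 * v + q`_2 * v ^+ 2.
  by rewrite (horner_coef_wide _ sq) !big_ord_recl big_ord0 /=; ring.
have q1 : q`_1 = 0.
  (* Any nonzero point where the known factor does not vanish would do. *)
  pose t : F := (2 * n).+1%:R.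
  have t0 : t != 0 by rewrite pnatr_eq0.
  have Q0 : odd_root_prod n t != 0 := odd_root_prod_neq0 n.
  have QN : odd_root_prod n (- t) = odd_root_prod n t.
    by apply: eq_bigr => i _; rewrite sqrrN.
  have := pev t; rewrite pq !hornerM !evrs QN => /(mulIf Q0).
  rewrite !eq sqrrN => /eqP; rewrite -subr_eq0.
  have -> : q`_0 + q`_1 * - t + q`_2 * t ^+ 2 - (q`_0 + q`_1 * t + q`_2 * t ^+ 2)
    = - 2 * t * q`_1 by ring.
  by rewrite !mulf_eq0 (negPf t0) oppr_eq0 pnatr_eq0 /= => /eqP.
exists q`_2, q`_0 => v.
by rewrite pq hornerM evrs eq q1; ring.
Qed.

(** It interpolates both products of shifted tau functions: one at v = c, the
    other at v = b. *)
Definition master_poly b c Z W m : {poly F} :=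
  let G := baker b c Z W m in
  Z *: (('X ^+ 2 - (b ^+ 2)%:P) * ((G \Po ('X - 1)) * (G \Po (- 'X - 1))))
  - W *: (('X ^+ 2 - (c ^+ 2)%:P) * ((G \Po ('X + 1)) * (G \Po (1 - 'X)))).

Lemma master_polyE b c Z W m v :
  (master_poly b c Z W m).[v] =
  let G := baker b c Z W m in
  Z * ((v ^+ 2 - b ^+ 2) * (G.[v - 1] * G.[- v - 1]))
  - W * ((v ^+ 2 - c ^+ 2) * (G.[v + 1] * G.[1 - v])).
Proof.
rewrite /master_poly /=.
by rewrite !(hornerD, hornerN, hornerZ, hornerM, horner_comp,
            hornerXn, hornerX, hornerC).
Qed.

Lemma size_master_poly b c Z W m :
  (size (master_poly b c Z W m) <= (2 * m).+3)%N.
Proof.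
rewrite /master_poly; set G := baker b c Z W m.
have sG : (size G <= m.+1)%N by apply: size_poly.
have comp (p : {poly F}) : (size p <= 2)%N -> (size (G \Po p) <= m.+1)%N.
  move=> sp; apply: leq_trans (size_comp_poly_leq _ _) _.
  rewrite ltnS -[leqRHS]muln1; apply: leq_mul.
    by move: sG; case: (size G).
  by move: sp; case: (size p).
have mul (p q : {poly F}) i j : (size p <= i.+1)%N -> (size q <= j.+1)%N ->
    (size (p * q)%R <= (i + j).+1)%N.
  move=> sp sq; apply: leq_trans (size_polyMleq _ _) _.
  by move: (size p) (size q) sp sq => s t; lia.
have key a (p q : {poly F}) r : (size p <= 2)%N -> (size q <= 2)%N ->
    (size (a *: (('X^2 - (r ^+ 2)%:P) * ((G \Po p) * (G \Po q))))%R <= (2 * m).+3)%N.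
  move=> sp sq; apply: leq_trans (size_scale_leq _ _) _.
  have -> : (2 * m).+3 = (2 + (m + m)).+1 by lia.
  by apply/mul/mul; rewrite ?comp // size_XnsubC.
have s1 : size ('X - 1 : {poly F}) = 2 by rewrite -polyC1 size_XsubC.
have s2 : size ('X + 1 : {poly F}) = 2 by rewrite -polyC1 size_XaddC.
have s3 : size (- 'X - 1 : {poly F}) = 2 by rewrite -opprD size_polyN s2.
have s4 : size (1 - 'X : {poly F}) = 2 by rewrite -opprB size_polyN s1.
apply: leq_trans (size_polyD _ _) _; rewrite geq_max size_polyN.
by rewrite !key ?s1 ?s2 ?s3 ?s4.
Qed.

(** At v = 2j + 1 the four values of the Baker polynomial are taken at the nodes
    of index j and j + 1, and the two gluing conditions there identify the two
    terms. For j = 0 the first condition is trivial. *)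
Lemma master_poly_root b c Z W m j : W != 0 -> odd_prod c m != 0 -> (j < m)%N ->
  (master_poly b c Z W m).[(2 * j).+1%:R] = 0.
Proof.
move=> W0 c0 jm; rewrite master_polyE /=; set G := baker b c Z W m.
have e1 : (2 * j).+1%:R - 1 = (2 * j)%:R :> F by rewrite -natr1 addrK.
have e2 : - (2 * j).+1%:R - 1 = - (2 * j.+1)%:R :> F.
  by rewrite mulnS addnC natrD -natr1; ring.
have e3 : (2 * j).+1%:R + 1 = (2 * j.+1)%:R :> F.
  by rewrite mulnS addnC natrD -natr1; ring.
have e4 : 1 - (2 * j).+1%:R = - (2 * j)%:R :> F by rewrite -natr1; ring.
rewrite e1 e2 e3 e4.
have cj : odd_prod c j != 0.
  apply/prodf_neq0 => i _; have /prodf_neq0 := c0.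
  by move/(_ (widen_ord (ltnW jm) i) isT).
have L1 : node_form b c Z W j.+1 G = 0 by apply: baker_annihilated.
have L0 : odd_prod c j * W ^+ j * G.[(2 * j)%:R]
          = odd_prod b j * Z ^+ j * G.[- (2 * j)%:R].
  case: j jm {e1 e2 e3 e4 cj L1} => [|j] jm.
    by rewrite /odd_prod !big_ord0 muln0 oppr0 !expr0.
  apply/eqP; rewrite -subr_eq0; apply/eqP; apply: baker_annihilated.
  by rewrite /= ltnW.
apply: (mulfI (mulf_neq0 cj (expf_neq0 j W0))); rewrite mulr0.
move: L1; rewrite /node_form !odd_prodS !exprS.
set u := (_.+1)%:R => L1.
transitivity (Z * ((u ^+ 2 - b ^+ 2) * G.[- (2 * j.+1)%:R])
   * (odd_prod c j * W ^+ j * G.[(2 * j)%:R])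
  - odd_prod c j * W ^+ j *
   (W * ((u ^+ 2 - c ^+ 2) * (G.[(2 * j.+1)%:R] * G.[- (2 * j)%:R])))).
  by ring.
(* L0 moves the node 2j to -2j; what is left is a multiple of L1. *)
rewrite L0 -[RHS](mulr0 (- G.[- (2 * j)%:R])) -[X in _ = _ * X]L1; ring.
Qed.

(** At the first odd integer that is not forced to be a root, the gluing
    condition at the node m + 2 fails, with defect [baker_next]. *)
Lemma master_poly_next b c Z W m :
  (baker b c Z W m.+1).[- (2 * m.+1)%:R] * tau b c Z W m.+2
  = - (odd_prod c m.+1 * W ^+ m.+1 * (master_poly b c Z W m.+1).[(2 * m.+1).+1%:R]).
Proof.
rewrite master_polyE /= -baker_next; set G := baker b c Z W m.+1.
have L1 : node_form b c Z W m.+1 G = 0 by apply: baker_annihilated; rewrite /=.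
move: L1; rewrite /node_form !(odd_prodS _ m.+1) ![_ ^+ m.+2]exprS.
have -> : (2 * m.+1).+1%:R - 1 = (2 * m.+1)%:R :> F by rewrite -natr1 addrK.
have -> : - (2 * m.+1).+1%:R - 1 = - (2 * m.+2)%:R :> F.
  by rewrite (mulnS 2 m.+1) addnC natrD -natr1; ring.
have -> : (2 * m.+1).+1%:R + 1 = (2 * m.+2)%:R :> F.
  by rewrite (mulnS 2 m.+1) addnC natrD -natr1; ring.
have -> : 1 - (2 * m.+1).+1%:R = - (2 * m.+1)%:R :> F by rewrite -natr1; ring.
set u := _.+1%:R; set A := odd_prod b _; set B := odd_prod c _ => L1.
(* The two sides differ by this multiple of the gluing condition L1. *)
rewrite -[RHS]addr0.
rewrite -[X in _ = _ + X](mulr0 (Z * (u ^+ 2 - b ^+ 2) * G.[- (2 * m.+2)%:R])).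
by rewrite -[X in _ = _ + _ * X]L1; ring.
Qed.

End Interpolation.

(** * The bilinear relation for the tau functions *)

Section Bilinear.
Variable R : comNzRingType.

(** The coefficient 2(m + 1) is the ratio of Vandermonde determinants of
    [node_vdm_ratio]; it disappears in terms of Umemura polynomials. *)
Definition hirota_form (b c Z W : R) m : R :=
  (2 * m.+1)%:R *
   ((c ^+ 2 - (2 * m.+1).+1%:R ^+ 2) * W
      * (tau (b - 2) c Z W m.+1 * tau (b + 2) c Z W m.+1)
    + ((2 * m.+1).+1%:R ^+ 2 - b ^+ 2) * Z
      * (tau b (c - 2) Z W m.+1 * tau b (c + 2) Z W m.+1))
  + tau b c Z W m * tau b c Z W m.+2.

End Bilinear.

Section Morphism.
Variables (R S : comNzRingType) (f : {rmorphism R -> S}).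

Lemma rmorph_odd_prod b n : f (odd_prod b n) = odd_prod (f b) n.
Proof.
rewrite rmorph_prod; apply: eq_bigr => i _.
by rewrite rmorphB !rmorphXn rmorph_nat.
Qed.

Lemma rmorph_tau b c Z W m : f (tau b c Z W m) = tau (f b) (f c) (f Z) (f W) m.
Proof.
rewrite /tau /moment -det_map_mx; congr (\det _); apply/matrixP => i j.
rewrite !mxE /node_form !hornerXn rmorphB !rmorphM !rmorphXn !rmorph_odd_prod.
by rewrite rmorphN !rmorph_nat.
Qed.

Lemma rmorph_hirota_form b c Z W m :
  f (hirota_form b c Z W m) = hirota_form (f b) (f c) (f Z) (f W) m.
Proof.
by rewrite /hirota_form !(rmorph_nat, rmorph_tau,
                          rmorphXn, rmorphM, rmorphB, rmorphD).
Qed.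

End Morphism.

Section HirotaRelation.
Variable F : numFieldType.
Implicit Types (b c Z W v : F).

(** By difference of squares, both sides are the product of the even integers
    from 2 to 4(m + 1). The right side is what [baker_edge] produces. *)
Lemma edge_product m :
  odd_root_prod m.+1 ((2 * m.+1).+1%:R : F)
  = (2 * m.+1)%:R * (-1) ^+ m * ((4 * m.+1)%:R
     * \prod_(i < m) ((2 * i.+1)%:R ^+ 2 - (2 * m.+1)%:R ^+ 2)).
Proof.
rewrite /odd_root_prod.
transitivity ((\prod_(j < m.+1) (2 * m.+1 - 2 * j)%:R)
             * (\prod_(j < m.+1) (2 * m.+1 + 2 * j.+1)%:R : F)).
  rewrite -big_split; apply: eq_bigr => j _ /=.
  rewrite natrB; last by have := ltn_ord j; lia.
  by rewrite (mulnS 2 j) !natrD -!natr1; ring.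
rewrite big_ord_recl [X in _ * X]big_ord_recr /= muln0 subn0.
rewrite (_ : 2 * m.+1 + 2 * m.+1 = 4 * m.+1)%N; last by lia.
rewrite -[m in (-1) ^+ m]card_ord -prodr_const.
rewrite -!mulrA; congr (_ * _).
rewrite [RHS]mulrCA mulrA mulrC; congr (_ * _).
rewrite -!big_split; apply: eq_bigr => i _ /=.
rewrite /bump /= natrB; last by have := ltn_ord i; lia.
by rewrite natrD add1n; ring.
Qed.

(** The multiplier collects the quantities by which the argument divides. The
    cofactor of the master polynomial has only two coefficients s2 and s0, so the
    values of the master polynomial at b, at c and at the next odd integer, which
    are the three terms of the relation, are linearly dependent. *)
Lemma hirota_form_generic b c Z W m : W != 0 ->
  odd_prod b m.+1 * odd_prod c m.+1 * (c ^+ 2 - b ^+ 2) * hirota_form b c Z W m = 0.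
Proof.
move=> W0.
have [->|c0] := eqVneq (odd_prod c m.+1) 0; first by rewrite mulr0 !mul0r.
have [s2 [s0 PE]] : exists s2 s0, forall v,
    (master_poly b c Z W m.+1).[v] = odd_root_prod m.+1 v * (s2 * v ^+ 2 + s0).
  apply: even_poly_factor => [v||j jm].
  - rewrite !master_polyE /= sqrrN opprK.
    rewrite [1 + v]addrC [- v + 1]addrC.
    by congr (_ * (_ * _) - _ * (_ * _)); apply: mulrC.
  - exact: size_master_poly.
  - exact: master_poly_root.
pose V : F := (2 * m.+1).+1%:R ^+ 2.
have edge : tau b c Z W m * tau b c Z W m.+2
    = (2 * m.+1)%:R * (-1) ^+ m * (s2 * V + s0).
  have := odd_root_prod_neq0 F m.+1; rewrite edge_product.
  set K := (4 * _)%:R * _ => K0.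
  have {}K0 : K != 0 by apply: contraNneq K0 => ->; rewrite mulr0.
  have := master_poly_next b c Z W m.
  rewrite PE edge_product baker_edge -/K => e.
  apply: (mulfI K0); apply: (mulfI (mulf_neq0 c0 (expf_neq0 m.+1 W0))).
  apply: oppr_inj; rewrite -/V in e; move: e; rewrite /K => e.
  transitivity (- ((4 * m.+1)%:R * odd_prod c m.+1 * W ^+ m.+1 *
       \prod_(i < m) ((2 * i.+1)%:R ^+ 2 - (2 * m.+1)%:R ^+ 2) * tau b c Z W m) *
      tau b c Z W m.+2); first by ring.
  by rewrite e; ring.
have eb := PE b; have ec := PE c; move: eb ec.
rewrite !master_polyE /= !subrr !mul0r !mulr0 subr0 sub0r !odd_root_prodE.
rewrite [b + 1]addrC -tau_shift1 -tau_shift2.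
rewrite /hirota_form edge -/V [(-1) ^+ m.+1]exprS.
set A := odd_prod b _; set B := odd_prod c _.
set t1 := tau _ _ _ _ _ * _; set t2 := tau _ _ _ _ _ * _.
set e := (-1) ^+ m => eb ec.
set N := (2 * m.+1)%:R.
transitivity (N * (B * (c ^+ 2 - V) * (- (W * ((b ^+ 2 - c ^+ 2) * (A * t1))))
  + A * (V - b ^+ 2) * (Z * ((c ^+ 2 - b ^+ 2) * (B * t2))))
  + A * B * (c ^+ 2 - b ^+ 2) * (N * e * (s2 * V + s0))); first by ring.
by rewrite eb ec; ring.
Qed.

Lemma poly_eq0_nat (p : {poly F}) : (forall n, p.[n%:R] = 0) -> p = 0.
Proof.
move=> p0; apply: (@roots_geq_poly_eq0 _ p [seq n%:R | n <- iota 0 (size p)]).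
- by apply/allP => _ /mapP[n _ ->]; apply/eqP.
- rewrite map_inj_uniq ?iota_uniq // => i j /eqP.
  by rewrite eqr_nat => /eqP.
- by rewrite size_map size_iota.
Qed.

Lemma linear_neq0 (u a : F) : a != 0 -> u%:P + a *: 'X != 0.
Proof.
move=> a0; apply/eqP => /(congr1 (fun p : {poly F} => p`_1)).
by rewrite coefD coefC coefZ coefX coef0 mulr1 add0r => /eqP; rewrite (negPf a0).
Qed.

Lemma odd_prod_linear_neq0 (u a : F) n : a != 0 -> odd_prod (u%:P + a *: 'X) n != 0.
Proof.
move=> a0; apply/prodf_neq0 => i _; rewrite subr_sqr mulf_neq0 //.
- rewrite (_ : _ - _ = ((2 * i).+1%:R - u)%:P + (- a) *: 'X).
    by rewrite linear_neq0 ?oppr_eq0.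
  by rewrite polyCB polyC_natr scaleNr opprD addrA.
- rewrite (_ : _ + (_ + _) = ((2 * i).+1%:R + u)%:P + a *: 'X) ?linear_neq0 //.
  by rewrite polyCD polyC_natr addrA.
Qed.

(** Perturbation from generic parameters. The slopes 1 and 2 differ and are not
    opposite, so that (c + 2t)^2 - (b + t)^2 is not identically zero. *)
Lemma hirota_form0 b c Z W m : W != 0 -> hirota_form b c Z W m = 0.
Proof.
move=> W0.
pose bX : {poly F} := b%:P + 1 *: 'X; pose cX : {poly F} := c%:P + 2 *: 'X.
pose E := hirota_form bX cX Z%:P W%:P m.
have ev (u a t : F) : horner_eval t (u%:P + a *: 'X) = u + a * t.
  by rewrite /horner_eval hornerD hornerC hornerZ hornerX.
have evE t : E.[t] = hirota_form (b + 1 * t) (c + 2 * t) Z W m.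
  rewrite -[LHS]/(horner_eval t E) rmorph_hirota_form /= /bX /cX !ev.
  by rewrite /horner_eval !hornerC.
suff E0 : E = 0 by have := evE 0; rewrite E0 horner0 !mulr0 !addr0.
pose C := odd_prod bX m.+1 * odd_prod cX m.+1 * (cX ^+ 2 - bX ^+ 2).
have C0 : C != 0.
  rewrite !mulf_neq0 ?odd_prod_linear_neq0 ?oner_eq0 ?pnatr_eq0 //.
  rewrite subr_sqr mulf_neq0 //.
  - rewrite (_ : cX - bX = (c - b)%:P + 1 *: 'X) ?linear_neq0 ?oner_eq0 //.
    rewrite /bX /cX polyCB -!mul_polyC polyC_natr polyC1; ring.
  - rewrite (_ : cX + bX = (c + b)%:P + 3 *: 'X) ?linear_neq0 ?pnatr_eq0 //.
    by rewrite /bX /cX polyCD -!mul_polyC !polyC_natr polyC1; ring.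
apply: (mulfI C0); rewrite mulr0; apply: poly_eq0_nat => n.
rewrite hornerM evE -[C.[_]]/(horner_eval _ C).
rewrite !(rmorphM, rmorphB, rmorphXn, rmorph_odd_prod) /= /bX /cX !ev.
exact: hirota_form_generic.
Qed.

End HirotaRelation.

(** * Umemura polynomials as determinants *)

Section PairProducts.
Variable R : comNzRingType.

Lemma prod_pairs n (t : 'I_n -> 'I_n -> R) : (forall i, t i i = 1) ->
  \prod_i \prod_j t i j = \prod_(i < n) \prod_(j < n | (i < j)%N) (t i j * t j i).
Proof.
move=> t1; transitivity (\prod_(i < n) ((\prod_(j < n | (i < j)%N) t i j)
                                  * \prod_(j < n | (j < i)%N) t i j)).
  apply: eq_bigr => i _; rewrite (bigID (fun j : 'I_n => (i < j)%N)) /=.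
  congr (_ * _); rewrite (bigD1 i) ?ltnn //= t1 mul1r; apply: eq_bigl => j.
  by rewrite -leqNgt ltn_neqAle andbC.
rewrite big_split /= [X in _ * X](exchange_big_dep predT) //= -big_split /=.
by apply: eq_bigr => i _; rewrite -big_split.
Qed.

Lemma prod_exp_pairs n (e : 'I_n -> R) :
  \prod_(i < n) \prod_(j < n | (i < j)%N) e j = \prod_(j < n) e j ^+ j.
Proof.
rewrite (exchange_big_dep predT) //=; apply: eq_bigr => j _.
by rewrite -(big_ord_widen n (fun=> e j) (ltnW (ltn_ord j))) prodr_const card_ord.
Qed.

(** Multilinearity in the rows: I is the set of rows taken from A. *)
Lemma det_row_sum n (x y : 'I_n -> R) (A B : 'M[R]_n) :
  \det (\matrix_(i, j) (x i * A i j + y i * B i j))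
  = \sum_(I : {set 'I_n}) (\prod_(i in I) x i) * (\prod_(i in ~: I) y i)
      * \det (\matrix_(i, j) (if i \in I then A i j else B i j)).
Proof.
transitivity (\sum_(s : 'S_n) \sum_(I : {set 'I_n})
   (-1) ^+ s * ((\prod_(i in I) x i) * (\prod_(i in ~: I) y i)
      * \prod_i (if i \in I then A i (s i) else B i (s i)))).
  apply: eq_bigr => s _; rewrite -big_distrr /=; congr (_ * _).
  under eq_bigr do rewrite mxE.
  rewrite bigA_distr; apply: eq_bigr => I _.
  rewrite [X in X * _ * _]big_mkcond [X in _ * X * _]big_mkcond -!big_split /=.
  apply: eq_bigr => i _; rewrite in_setC.
  by case: ifP => _ /=; rewrite ?mulr1 ?mul1r.
rewrite exchange_big; apply: eq_bigr => I _ /=.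
rewrite /determinant big_distrr /=; apply: eq_bigr => s _.
rewrite mulrCA; congr (_ * (_ * _)).
by apply: eq_bigr => i _; rewrite mxE.
Qed.

End PairProducts.

Section Expansion.
Variable F : numFieldType.

(** The Vandermonde determinant of the nodes 2, 4, ..., 2m, see
    [node_vdm_pairs]. *)
Definition node_vdm (m : nat) : F :=
  \prod_(j < m) \prod_(i < j) ((2 * (j - i))%N)%:R.

Lemma node_vdm_neq0 m : node_vdm m != 0.
Proof.
apply/prodf_neq0 => j _; apply/prodf_neq0 => i _; rewrite pnatr_eq0.
by have := ltn_ord i; lia.
Qed.

Lemma node_vdm_ratio m :
  node_vdm m * node_vdm m.+2 = (2 * m.+1)%:R * node_vdm m.+1 ^+ 2.
Proof.
rewrite /node_vdm 2!big_ord_recr /=.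
rewrite [X in _ * (_ * X)]big_ord_recl subn0.
under [X in _ * (_ * (_ * X))]eq_bigr do rewrite /= subSS.
ring.
Qed.

Lemma node_vdm_pairs m :
  node_vdm m = \prod_(i < m) \prod_(j < m | (i < j)%N) ((elt j)%:R - (elt i)%:R).
Proof.
rewrite (exchange_big_dep predT) //=; apply: eq_bigr => j _.
rewrite (big_ord_widen _ (fun i => (2 * (j - i))%:R : F) (ltnW (ltn_ord j))).
apply: eq_bigr => i ij; rewrite -natrB /elt; last by lia.
by congr (_%:R); lia.
Qed.

Definition crossing (m : nat) (I : {set 'I_m}) : F :=
  \prod_(i in I) \prod_(j in ~: I)
       `| ((elt i)%:R + (elt j)%:R) / ((elt i)%:R - (elt j)%:R) |.

(** Reversing the sign of the nodes in I leaves a difference of two nodes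
    unchanged up to sign when both or none of them lie in I, and replaces it by
    their sum, up to sign, otherwise. The sign is that of the larger node, and
    the node of index i is the larger one in i pairs. *)
Lemma signed_vdm m (I : {set 'I_m}) :
  \prod_(i < m) \prod_(j < m | (i < j)%N)
     ((if j \in I then - (elt j)%:R else (elt j)%:R)
      - (if i \in I then - (elt i)%:R else (elt i)%:R))
  = node_vdm m * (\prod_(i in I) (-1) ^+ i) * crossing I.
Proof.
pose t i j : F := if (i \in I) && (j \notin I)
  then `| ((elt i)%:R + (elt j)%:R) / ((elt i)%:R - (elt j)%:R) | else 1.
have -> : crossing I = \prod_i \prod_j t i j.
  rewrite /crossing big_mkcond; apply: eq_bigr => i _; rewrite /t.
  case: ifP => [iI|_] /=; last by rewrite big1.
  by rewrite big_mkcond; apply: eq_bigr => j _; rewrite in_setC.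
rewrite prod_pairs; last by move=> i; rewrite /t; case: (i \in I).
have -> : \prod_(i in I) (-1) ^+ i
   = \prod_(i < m) \prod_(j < m | (i < j)%N) (if j \in I then -1 else 1) :> F.
  rewrite prod_exp_pairs big_mkcond; apply: eq_bigr => i _.
  by case: ifP => _ //; rewrite expr1n.
rewrite node_vdm_pairs -!big_split; apply: eq_bigr => i _ /=.
rewrite -!big_split; apply: eq_bigr => j ij /=.
have lt : (elt i)%:R < (elt j)%:R :> F by rewrite ltr_nat /elt; lia.
have ne : (elt j)%:R - (elt i)%:R != 0 :> F by rewrite subr_eq0 gt_eqF.
have abs1 : `| ((elt i)%:R + (elt j)%:R) / ((elt i)%:R - (elt j)%:R) |
    = ((elt i)%:R + (elt j)%:R) / ((elt j)%:R - (elt i)%:R) :> F.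
  rewrite normf_div (ger0_norm (addr_ge0 _ _)) ?ler0n //.
  by rewrite ltr0_norm ?subr_lt0 // opprB.
have abs2 : `| ((elt j)%:R + (elt i)%:R) / ((elt j)%:R - (elt i)%:R) |
    = ((elt i)%:R + (elt j)%:R) / ((elt j)%:R - (elt i)%:R) :> F.
  by rewrite -abs1 [(elt j)%:R + _]addrC -opprB invrN mulrN normrN.
by rewrite /t abs1 abs2; case: (i \in I); case: (j \in I) => /=; field.
Qed.

Lemma coef_odd_prod (beta : F) m (i : 'I_m) :
  coef (- 4 * beta ^+ 2) (elt i) = odd_prod (2 * beta) i.+1.
Proof.
rewrite /coef /odd_prod /elt mul2n doubleK big_add1 /= big_mkord.
by apply: eq_bigr => j _; rewrite /bar mulnS natrD -natr1; ring.
Qed.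

Lemma wt_half m (I : {set 'I_m}) : ((wt I)./2 = \sum_(i in I) i.+1)%N.
Proof. by rewrite /wt /elt -big_distrr /= mul2n doubleK. Qed.

(** The row of index i is a combination of the powers of the nodes elt i and
    - elt i, so every term of [det_row_sum] is a Vandermonde determinant. The
    signs of [signed_vdm] and the minus sign of the form at each node combine to
    the exponent (wt I)./2. *)
Lemma tau_Umemura m (z w beta1 beta2 : F) :
  tau (2 * beta1) (2 * beta2) (z ^+ 2) (w ^+ 2) m
  = node_vdm m * Umemura m z w beta1 beta2.
Proof.
pose x (i : 'I_m) : F := - (odd_prod (2 * beta1) i.+1 * (z ^+ 2) ^+ i.+1).
pose y (i : 'I_m) : F := odd_prod (2 * beta2) i.+1 * (w ^+ 2) ^+ i.+1.
pose A : 'M[F]_m := \matrix_(i, j) (- (elt i)%:R) ^+ j.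
pose B : 'M[F]_m := \matrix_(i, j) (elt i)%:R ^+ j.
transitivity (\det (\matrix_(i, j) (x i * A i j + y i * B i j))).
  congr (\det _); apply/matrixP => i j; rewrite !mxE /node_form !hornerXn /x /y.
  by rewrite addrC mulNr.
rewrite det_row_sum /Umemura /U0 big_distrr; apply: eq_bigr => I _ /=.
have -> : \det (\matrix_(i, j) (if i \in I then A i j else B i j))
    = node_vdm m * (\prod_(i in I) (-1) ^+ i) * crossing I.
  rewrite -signed_vdm -det_tr.
  pose a : 'rV[F]_m := \row_i (if i \in I then - (elt i)%:R else (elt i)%:R).
  transitivity (\det (Vandermonde m a)).
    by congr (\det _); apply/matrixP => i j; rewrite !mxE; case: ifP.
  rewrite det_Vandermonde; apply: eq_bigr => i _; apply: eq_bigr => j _.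
  by rewrite !mxE.
rewrite -/(crossing I) wt_half /wt !expr_sum /coef_set.
have -> : \prod_(i in I) x i = \prod_(i in I) (-1) *
    ((\prod_(i in I) coef (- 4 * beta1 ^+ 2) (elt i)) * \prod_(i in I) z ^+ elt i).
  rewrite -!big_split; apply: eq_bigr => i _ /=.
  by rewrite /x coef_odd_prod /elt exprM mulN1r.
have -> : \prod_(i in ~: I) y i =
    (\prod_(i in ~: I) coef (- 4 * beta2 ^+ 2) (elt i))
    * \prod_(i in ~: I) w ^+ elt i.
  rewrite -!big_split; apply: eq_bigr => i _ /=.
  by rewrite /y coef_odd_prod /elt exprM.
under [X in _ = _ * (_ * X * _ * _ * _ * _)]eq_bigr do rewrite exprS.
rewrite big_split /=; ring.
Qed.

Lemma Umemura_bilinear m (z w beta1 beta2 : F) : w != 0 ->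
  (4 * beta2 ^+ 2 - (2 * m.+1%:R + 1) ^+ 2) * w ^+ 2
    * (Umemura m.+1 z w (beta1 - 1) beta2 * Umemura m.+1 z w (beta1 + 1) beta2)
  + (- 4 * beta1 ^+ 2 + (2 * m.+1%:R + 1) ^+ 2) * z ^+ 2
    * (Umemura m.+1 z w beta1 (beta2 - 1) * Umemura m.+1 z w beta1 (beta2 + 1))
  + Umemura m z w beta1 beta2 * Umemura m.+2 z w beta1 beta2 = 0.
Proof.
move=> w0.
have := @hirota_form0 F (2 * beta1) (2 * beta2) (z ^+ 2) (w ^+ 2) m (expf_neq0 2 w0).
rewrite /hirota_form.
have eB (beta : F) : 2 * beta - 2 = 2 * (beta - 1) by ring.
have eD (beta : F) : 2 * beta + 2 = 2 * (beta + 1) by ring.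
rewrite !eB !eD !tau_Umemura -natr1 natrM => e.
have N0 : (2 * m.+1)%:R * node_vdm m.+1 ^+ 2 != 0.
  by rewrite mulf_neq0 ?expf_neq0 ?node_vdm_neq0 ?pnatr_eq0.
apply: (mulfI N0); rewrite mulr0 -[RHS]e.
rewrite [X in _ = _ + X]mulrACA node_vdm_ratio natrM; ring.
Qed.

End Expansion.

(** * The rescaling factors *)

Section Rescaling.
Variable F : comNzRingType.
Implicit Types (f g : int -> F) (m : int).

Definition step_prod f m n : F :=
  \prod_(1 <= j < n.+1) f (m - n%:Z - 1 + 2 * j%:Z).

(** The products Y_ and Z_ are [step_prod] of Ybar and Zbar, and the two factors
    of Xfac are [tri_prod]: a product over a triangle of points whose second
    coordinate m moves in steps of 2. *)
Definition tri_prod f m k : F := \prod_(1 <= j < k) step_prod f m j.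

(** The two progressions of step 2 on the left and on the right have the same
    union, counted with multiplicity. *)
Lemma step_prod_mul f m n :
  step_prod f m n * step_prod f m n.+2
  = step_prod f (m - 1) n.+1 * step_prod f (m + 1) n.+1.
Proof.
rewrite /step_prod [X in _ * X]big_nat_recr // [X in _ = _ * X]big_nat_recr //=.
rewrite mulrCA; congr (_ * (_ * _)).
- by apply: eq_bigr => j _; congr f; lia.
- by apply: eq_bigr => j _; congr f; lia.
- by congr f; lia.
Qed.

Lemma tri_prodS f m k : tri_prod f m k.+1 = tri_prod f m k * step_prod f m k.
Proof.
rewrite /tri_prod; case: k => [|k]; last by rewrite big_nat_recr.
by rewrite /step_prod !big_geq // mulr1.
Qed.

(** The relation of [step_prod_mul] telescopes along the triangle; only its
    vertex f m is left over. *)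
Lemma tri_prod_mul f m k :
  tri_prod f m k * tri_prod f m k.+2
  = f m * (tri_prod f (m - 1) k.+1 * tri_prod f (m + 1) k.+1).
Proof.
elim: k => [|k IH].
  rewrite /tri_prod [X in X * _]big_geq // !(big_geq (leqnn 1)) big_nat1.
  by rewrite /step_prod big_nat1 !mulr1 mul1r; congr f; lia.
rewrite [X in X * _]tri_prodS [X in _ * X]tri_prodS mulrACA IH step_prod_mul.
by rewrite ![in RHS](tri_prodS _ _ k.+1); ring.
Qed.

Lemma tri_prod_shift f1 f2 g m k :
  (forall n, f1 n * f2 n = g (n - 1) * g (n + 1)) ->
  tri_prod f1 m k * tri_prod f2 m k = tri_prod g (m - 1) k * tri_prod g (m + 1) k.
Proof.
move=> fg; rewrite -!big_split; apply: eq_bigr => n _ /=.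
rewrite -!big_split; apply: eq_bigr => j _ /=.
by rewrite fg; congr (g _ * g _); lia.
Qed.

End Rescaling.

Section RescalingRelations.
Variable F : numFieldType.
Variables (b1 b2 z w : F).

Lemma XfacE k l m : Xfac b1 b2 z w k l m
  = tri_prod (Ybar b2 w l%:Z) m%:Z k * tri_prod (Zbar b1 z k%:Z) m%:Z l.
Proof. by []. Qed.

(** The factor in Ybar is a triangle that grows with k. The factor in Zbar has
    constant size, and for it the shifts of k and of m have the same effect
    because Zbar is a product of affine forms in k + m and in k - m. *)
Lemma Xfac_k k l m :
  Xfac b1 b2 z w k l m.+1 * Xfac b1 b2 z w k.+2 l m.+1
  = Ybar b2 w l%:Z m.+1%:Z * (Xfac b1 b2 z w k.+1 l m * Xfac b1 b2 z w k.+1 l m.+2).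
Proof.
rewrite !XfacE mulrACA tri_prod_mul.
rewrite (@tri_prod_shift _ _ _ (Zbar b1 z k.+1%:Z)) => [|n].
  have -> : m.+1%:Z - 1 = m by lia.
  have -> : m.+1%:Z + 1 = m.+2 by lia.
  by ring.
rewrite /Zbar !(intrD, intrB, natr1) -!natr1 /=; ring.
Qed.

Lemma Xfac_l k l m :
  Xfac b1 b2 z w k l m.+1 * Xfac b1 b2 z w k l.+2 m.+1
  = Zbar b1 z k%:Z m.+1%:Z * (Xfac b1 b2 z w k l.+1 m * Xfac b1 b2 z w k l.+1 m.+2).
Proof.
rewrite !XfacE mulrACA tri_prod_mul.
rewrite (@tri_prod_shift _ _ _ (Ybar b2 w l.+1%:Z)) => [|n].
  have -> : m.+1%:Z - 1 = m by lia.
  have -> : m.+1%:Z + 1 = m.+2 by lia.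
  by ring.
rewrite /Ybar !(intrD, intrB, natr1) -!natr1 /=; ring.
Qed.

End RescalingRelations.

(** * The Hirota-Miwa equation *)

Lemma wfun_neq0 (R : realType) (x : R) : wfun x != 0.
Proof.
rewrite /wfun rmorphM mulf_neq0 //; first by rewrite fmorph_eq0 invr_eq0 pnatr_eq0.
rewrite fmorph_eq0 sqrtr_eq0 -ltNge.
by rewrite !addr_gt0 ?expR_gt0.
Qed.

Theorem proposition5 (R : realType) (b1 b2 : R[i]) (k l m : nat)
    (hk : (1 <= k)%N) (hl : (1 <= l)%N) (hm : (1 <= m)%N)
    (x : R) (hx : 0 < x) :
  T_ b1 b2 k.-1 l m x * T_ b1 b2 k.+1 l m x
  + T_ b1 b2 k l.-1 m x * T_ b1 b2 k l.+1 m x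
  + T_ b1 b2 k l m.-1 x * T_ b1 b2 k l m.+1 x = 0.
Proof.
case: k l m hk hl hm => [|k] [|l] [|m] //= _ _ _; rewrite /T_.
rewrite ![_ * Xfac _ _ _ _ _ _ _ * _]mulrACA Xfac_k Xfac_l.
have := Umemura_bilinear m (zfun x) (b1 + k.+1%:R) (b2 + l.+1%:R) (wfun_neq0 x).
have eB (b : R[i]) n : b + n.+1%:R - 1 = b + n%:R by rewrite -natr1; ring.
have eD (b : R[i]) n : b + n.+1%:R + 1 = b + n.+2%:R.
  by rewrite -[n.+2%:R]natr1 addrA.
rewrite !eB !eD /Ybar /Zbar => e.
(* The common factor of the three terms. *)
rewrite -[RHS](mulr0 (Xfac b1 b2 (zfun x) (wfun x) k.+1 l.+1 m
   * Xfac b1 b2 (zfun x) (wfun x) k.+1 l.+1 m.+2)) -[X in _ = _ * X]e.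
ring.
Qed.
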